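(* Fix $k>0$ and an interval $I=[\theta_1,\theta_N]\subsetneq[0,2\pi]$ with $\theta_1<\theta_N$. Let monostatic far-field data $\{u_\infty(\hat x_n;k): n=1,\dots,N\}$ be given for $\hat x_n=[\cos\theta_n,\sin\theta_n]^T$, where $\theta_1,\dots,\theta_N$ are equidistant points of $I$ (the endpoints of $I$ being the first and the last of them). For $z$ in a compact test domain $\Omega\subset\mathbb{R}^2$ define $$\mathcal{I}_{\mathrm{MSM}}(z;k)=\frac{\left|\frac1N\sum_{n=1}^N u_\infty(\hat x_n;k)\,\overline{e^{-2\mathrm{i}k\hat x_n\cdot z}}\right|}{\max_{y\in\Omega}\left|\frac1N\sum_{n=1}^N u_\infty(\hat x_n;k)\,\overline{e^{-2\mathrm{i}k\hat x_n\cdot y}}\right|}.$$ Set $w_m=\alpha_m^2(\varepsilon_m-\varepsilon_0)|D_m|$ for $m=1,\dots,M$. Then, for sufficiently large $N$, $$\mathcal{I}_{\mathrm{MSM}}(z;k)\approx\frac{\left|\Phi_{\mathrm{MSM}}(z;k)+\Lambda_{\mathrm{MSM}}(z;k)\right|}{\max_{y\in\Omega}\left|\Phi_{\mathrm{MSM}}(y;k)+\Lambda_{\mathrm{MSM}}(y;k)\right|},\qquad z\in\Omega,$$ where $$\Phi_{\mathrm{MSM}}(z;k)=\sum_{m=1}^M w_m J_0(2k|z-c_m|),\qquad \Lambda_{\mathrm{MSM}}(z;k)=\sum_{m=1}^M w_m R(z-c_m,2k;\theta_1,\theta_N).$$ Here $\approx$ is understood as equality to leading order: when the $O(\alpha^3)$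 remainder in the data $u_\infty$ is discarded, the left-hand side converges, as $N\to\infty$ with the endpoints of $I$ fixed, to the right-hand side (the denominator on the right being understood to be nonzero, so that the formula is defined).
   Context: Setting: two-dimensional scattering by $M$ non-magnetic dielectric inhomogeneities $\tau_m=c_m+\alpha_m D_m\subset\mathbb{R}^2$ ($m=1,\dots,M$), with center $c_m\in\mathbb{R}^2$, size $\alpha_m>0$, reference shape $D_m$ of area $|D_m|$, and permittivity $\varepsilon_m>0$, in a homogeneous background of permittivity $\varepsilon_0>0$ and permeability $\mu_0>0$ (all inhomogeneities also have permeability $\mu_0$). The angular frequency is $\omega>0$, the wavenumber is $k=\omega\sqrt{\varepsilon_0\mu_0}$ and the wavelength is $\lambda=2\pi/k$. The inhomogeneities are small, $\alpha=\max_m\alpha_m\ll\lambda/2$, and well separated: $\mathrm{dist}(\tau_m,\tau_{m'})>l$ for $m\ne m'$, for some constant $l>0$. For the incident plane wave $e^{\mathrm{i}k\vartheta\cdot x}$, $\vartheta\in\mathbb{S}^1$, let $u_\infty(\hat x,\vartheta;k)$ be the far-field pattern of the scattered field. The monostatic data are $u_\infty(\hat x;k):=u_\infty(\hat x,-\hat x;k)$, and they satisfy the (known) asymptotic formula $$u_\infty(\hat x;k)=\sum_{m=1}^M\alpha_m^2|D_m|\frac{\varepsilon_m-\varepsilon_0}{\sqrt{\varepsilon_0\mu_0}}e^{-2\mathrm{i}k\hat x\cdot c_m}+O(\alpha^3).$$ Notation: $J_s$ is the Bessel function of the first kind of order $s$; $\mathrm{sinc}(t)=\sin(t)/t$ (with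 $\mathrm{sinc}(0)=1$); $\varphi(z)$ is the polar angle of $z\in\mathbb{R}^2$ (its value at $z=0$ is immaterial); and, for $z\in\mathbb{R}^2$ and $k>0$, $$R(z,k;\theta_1,\theta_N)=2\sum_{s=1}^\infty \mathrm{i}^s J_s(k|z|)\cos\left(\frac{s(\theta_N+\theta_1-2\varphi(z))}{2}\right)\mathrm{sinc}\left(\frac{s(\theta_N-\theta_1)}{2}\right).$$ *)

(* Defs.v *)
From HB Require Import structures.
From mathcomp Require Import all_boot all_order all_algebra.
From mathcomp Require Import all_classical all_reals all_analysis.
From mathcomp Require Import complex.

Set Implicit Arguments.
Unset Strict Implicit.
Unset Printing Implicit Defensive.

Import Order.TTheory GRing.Theory Num.Theory.
Import numFieldNormedType.Exports.

Local Open Scope classical_set_scope.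
Local Open Scope complex_scope.
Local Open Scope ring_scope.

Section Defs.
Context {R : realType}.

(* The plane is R * R. The library norm on a product is the sup norm, so the
   Euclidean structure is spelled out; the topology is the same. *)
Definition dot (x y : R * R) : R := x.1 * y.1 + x.2 * y.2.
Definition enorm (x : R * R) : R := Num.sqrt (dot x x).

Definition dist_sets (A B : set (R * R)) : R :=
  inf [set enorm (p.1 - p.2) | p in A `*` B].

Definition plane_measurable (D : set (R * R)) : Prop :=
  @measurable _ (measurableTypeR R * measurableTypeR R)%type D.

Definition area (D : set (R * R)) : R :=
  fine ((@lebesgue_measure R \x @lebesgue_measure R)%E D).

(* The set c + a D. *)
Definition inhomogeneity (c : R * R) (a : R) (D : set (R * R)) : set (R * R) :=
  [set (c.1 + a * x.1, c.2 + a * x.2) | x in D].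

(* The polar angle in ]-pi, pi] of z <> 0. *)
Definition polar_angle (z : R * R) : R :=
  if 0 <= z.2 then acos (z.1 / enorm z) else - acos (z.1 / enorm z).

Definition unit_vec (t : R) : R * R := (cos t, sin t).

(* exp (i t) *)
Definition expi (t : R) : R[i] := cos t +i* sin t.

Definition cmod (z : R[i]) : R := ComplexField.Normc.normc z.

Definition sinc (t : R) : R := if t == 0 then 1 else sin t / t.

(* Bessel function of the first kind, of order s. *)
Definition besselJ (s : nat) (x : R) : R :=
  limn (fun n => \sum_(0 <= l < n)
    (-1) ^+ l / (l`! * (l + s)`!)%:R * (x / 2) ^+ (l.*2 + s)).

(* The sum u 1 + u 2 + ...; R[i]^o carries the topology of the modulus. *)
Definition csum1 (u : nat -> R[i]) : R[i] :=
  limn (fun n => (\sum_(1 <= s < n) u s : R[i]^o)).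

(* R(z, k; t1, tN) *)
Definition Rker (z : R * R) (k t1 tN : R) : R[i] :=
  2 * csum1 (fun s => 'i%C ^+ s *
    (besselJ s (k * enorm z)
     * cos (s%:R * (tN + t1 - 2 * polar_angle z) / 2)
     * sinc (s%:R * (tN - t1) / 2))%:C).

(* The monostatic far-field pattern at xhat with the O(alpha^3) remainder of
   its small-volume expansion discarded. *)
Definition far_field_lead (M : nat) (c : 'I_M -> R * R) (alpha : 'I_M -> R)
    (D : 'I_M -> set (R * R)) (eps : 'I_M -> R) (eps0 mu0 k : R)
    (xhat : R * R) : R[i] :=
  \sum_(m < M)
    (alpha m ^+ 2 * area (D m) * ((eps m - eps0) / Num.sqrt (eps0 * mu0)))%:C
    * expi (- (2 * k * dot xhat (c m))).

(* N equidistant points of [t1, tN], endpoints included, indexed from 0;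
   meaningful for N >= 2. *)
Definition obs_angle (t1 tN : R) (N : nat) (n : nat) : R :=
  t1 + n%:R / N.-1%:R * (tN - t1).

Definition sampled_average (u : R * R -> R[i]) (k t1 tN : R) (N : nat)
    (z : R * R) : R[i] :=
  N%:R^-1 * \sum_(n < N)
    let xhat := unit_vec (obs_angle t1 tN N n) in
    u xhat * conjc (expi (- (2 * k * dot xhat z))).

(* All moduli normalized below are continuous, so that the supremum over a
   nonempty compact set is the maximum. *)
Definition max_mod (Omega : set (R * R)) (F : R * R -> R[i]) : R :=
  sup [set cmod (F y) | y in Omega].

Definition I_MSM (Omega : set (R * R)) (u : R * R -> R[i]) (k t1 tN : R)
    (N : nat) (z : R * R) : R :=
  cmod (sampled_average u k t1 tN N z)
  / max_mod Omega (sampled_average u k t1 tN N).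

Definition weight (alpha eps eps0 : R) (D : set (R * R)) : R :=
  alpha ^+ 2 * (eps - eps0) * area D.

Definition Phi_MSM (M : nat) (w : 'I_M -> R) (c : 'I_M -> R * R) (k : R)
    (z : R * R) : R :=
  \sum_(m < M) w m * besselJ 0 (2 * k * enorm (z - c m)).

Definition Lambda_MSM (M : nat) (w : 'I_M -> R) (c : 'I_M -> R * R)
    (k t1 tN : R) (z : R * R) : R[i] :=
  \sum_(m < M) (w m)%:C * Rker (z - c m) (2 * k) t1 tN.

End Defs.

Lemma polar_angleP (R : realType) (z : R * R) :
  z = (enorm z * cos (polar_angle z), enorm z * sin (polar_angle z)).
Proof.
case: z => a b; rewrite /polar_angle /=.
set r := enorm (a, b).
have r2 : r ^+ 2 = a ^+ 2 + b ^+ 2.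
  by rewrite sqr_sqrtr /dot /= -!expr2 // addr_ge0 ?sqr_ge0.
have [r0|r0] := eqVneq r 0.
  move: r2; rewrite r0 expr0n /= => /esym/eqP.
  rewrite paddr_eq0 ?sqr_ge0// !sqrf_eq0 => /andP[/eqP -> /eqP ->].
  by rewrite !mul0r.
have rp : 0 < r by rewrite lt_def r0 sqrtr_ge0.
have ar : (a / r) ^+ 2 = 1 - (b / r) ^+ 2.
  apply/eqP; rewrite eq_sym subr_eq !expr_div_n -mulrDl -r2 divff//.
  by rewrite sqrf_eq0.
have hI : -1 <= a / r <= 1.
  rewrite -ler_norml -(@ler_pXn2r _ 2) ?nnegrE// expr1n real_normK ?num_real//.
  by rewrite ar gerBl sqr_ge0.
have br : Num.sqrt (1 - (a / r) ^+ 2) = `|b| / r.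
  by rewrite ar subKr sqrtr_sqr normrM normfV (gtr0_norm rp).
case: ifPn => hb.
  by rewrite acosK// sin_acos// br ger0_norm// ![r * _]mulrC !divfK.
rewrite cosN sinN acosK// sin_acos// br ltr0_norm ?ltNge//.
by rewrite mulNr opprK ![r * _]mulrC !divfK.
Qed.

Lemma csum1P (R : realType) (u : nat -> R[i]) (l : R[i])
  (ha : (fun n => \sum_(1 <= s < n) complex.Re (u s)) @ \oo --> complex.Re l)
  (hb : (fun n => \sum_(1 <= s < n) complex.Im (u s)) @ \oo --> complex.Im l) :
  csum1 u = l.
Proof.
have := @cvg_lim (R[i]^o : ptopologicalType) (@norm_hausdorff _ (R[i]^o : normedModType R[i])) nat \oo _ (fun n => (\sum_(1 <= s < n) u s : R[i]^o)) l; apply.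
apply/cvgrPdist_lt => e e0.
have [e' e'0 ->] : exists2 e' : R, 0 < e' & e = e'%:C.
  case: e e0 => a b; rewrite ltcE /= => /andP[/eqP -> ha0]; by exists a.
have h2 : 0 < e' / 2 by rewrite divr_gt0.
move/cvgrPdist_lt: ha => /(_ _ h2) ha; move/cvgrPdist_lt: hb => /(_ _ h2) hb.
near=> n.
have h1 : `|complex.Re l - \sum_(1 <= s < n) complex.Re (u s)| < e'/2 by near: n.
have h3 : `|complex.Im l - \sum_(1 <= s < n) complex.Im (u s)| < e'/2 by near: n.
set S := (X in `|l - X|).
have [E1 E2]: complex.Re S = \sum_(1 <= s < n) complex.Re (u s) /\ complex.Im S = \sum_(1 <= s < n) complex.Im (u s).
  by rewrite /S; split; [apply: (big_morph (@complex.Re R)) | apply: (big_morph (@complex.Im R))]; (try by move=> [? ?] [? ?]).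
rewrite -E1 in h1; rewrite -E2 in h3.
clearbody S.
have -> : l - S = (complex.Re l - complex.Re S) +i* (complex.Im l - complex.Im S).
  by case: (l) (S) => ? ? [].
rewrite normc_def ltcR /=.
move: h1 h3; set x := complex.Re l - _; set y := complex.Im l - _ => h1 h3.
apply: (@le_lt_trans _ _ (`|x| + `|y|)); last by rewrite [e']splitr ltrD.
rewrite -(ger0_norm (addr_ge0 (normr_ge0 x) (normr_ge0 y))) -(sqrtr_sqr (`|x| + `|y|)) ler_wsqrtr// [leRHS]sqrrD.
by rewrite !real_normK ?num_real// -addrA [X in _ <= _ + X]addrC lerD2l lerDl mulrn_wge0 ?mulr_ge0.
Unshelve. all: by end_near.
Qed.

(* Main.v *)
Require Import Defs.
From HB Require Import structures.
From mathcomp Require Import all_boot all_order all_algebra.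
From mathcomp Require Import all_classical all_reals all_analysis.
From mathcomp Require Import complex.
From mathcomp Require Import ring zify.

Set Implicit Arguments.
Unset Strict Implicit.
Unset Printing Implicit Defensive.

Import Order.TTheory GRing.Theory Num.Theory.
Import numFieldNormedType.Exports.

Local Open Scope classical_set_scope.
Local Open Scope complex_scope.
Local Open Scope ring_scope.

(** With the remainder discarded, the sampled average of the data is
    (eps0 mu0)^(-1/2) times the sum over m of w_m times
    (1/N) sum_n exp (i x cos (theta_n - phi)), where x = 2 k |z - c_m| and phi is
    the polar angle of z - c_m; the prefactor cancels in the normalized
    indicator. The Jacobi-Anger expansion
      exp (i x cos psi) = J_0(x) + 2 sum_(s >= 1) i^s J_s(x) cos (s psi)
    (jacobi_anger) turns each such average into a series whose s-th term contains
    the average of cos (s (theta_n - phi)). That average is a Riemann sum of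
      (tN - t1)^-1 int_t1^tN cos (s (theta - phi)) dtheta
        = cos (s (tN + t1 - 2 phi) / 2) sinc (s (tN - t1) / 2),
    with an error at most s (tN - t1 + 2) / N (cos_average). Since |J_s(x)| is at
    most X^s / s! exp (X^2) for |x| <= X (besselJ_le), the errors sum to O(1/N),
    uniformly in x on bounded sets and in phi (expi_average). The limit is
    J_0(x) + R, so the sampled averages converge to the predicted function
    uniformly on the bounded set Omega. Their suprema over Omega then converge as
    well, and so does the quotient, the limit of the denominators being nonzero
    (normalized_cvg).

    Integrals are avoided: the mean of a cosine is expressed through the
    increment of the sine, which telescopes along the sampling points.

    The Jacobi-Anger expansion is obtained from the exponential series of
    i x cos psi = a + b with a = i (x/2) e^(i psi), b = i (x/2) e^(-i psi).
    The partial sums of exp (a + b) run over pairs of exponents (j, i) with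
    j + i < n; collecting the pairs by their difference s = |j - i|, and using
    a b = - (x/2)^2, produces exactly truncated Bessel series
    (exp_sum_by_difference, exp_sum_jacobi). The terms truncated away have total
    degree at least n, and a geometric factor 2^-n bounds them
    (besselJ_truncation). *)

(** * Modulus and exponential of complex numbers *)

Section Modulus.
Context {R : realType}.
Implicit Types (z u v : R[i]) (a : R).

Lemma cmod_ge0 z : 0 <= cmod z.
Proof. by case: z => x y; rewrite sqrtr_ge0. Qed.

Lemma cmod0 : cmod (0 : R[i]) = 0.
Proof. exact: ComplexField.Normc.normc0. Qed.

Lemma cmodM u v : cmod (u * v) = cmod u * cmod v.
Proof. exact: ComplexField.Normc.normcM. Qed.

Lemma cmodN z : cmod (- z) = cmod z.
Proof. by rewrite /cmod normcN. Qed.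

Lemma cmodD u v : cmod (u + v) <= cmod u + cmod v.
Proof. exact: le_normcD. Qed.

Lemma cmodB u v : cmod (u - v) = cmod (v - u).
Proof. by rewrite -cmodN opprB. Qed.

Lemma cmod_sum (I : Type) (r : seq I) (P : pred I) (F : I -> R[i]) :
  cmod (\sum_(i <- r | P i) F i) <= \sum_(i <- r | P i) cmod (F i).
Proof.
elim/big_ind2: _ => [|u a v b ua vb|//]; first by rewrite cmod0.
by rewrite (le_trans (cmodD _ _))// lerD.
Qed.

Lemma cmod_real a : cmod a%:C = `|a|.
Proof. by rewrite /cmod /= expr0n addr0 sqrtr_sqr. Qed.

Lemma cmod_nat n : cmod (n%:R : R[i]) = n%:R.
Proof. by rewrite -(rmorph_nat (real_complex R)) cmod_real normr_nat. Qed.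

Lemma cmodV z : cmod z^-1 = (cmod z)^-1.
Proof. exact: ComplexField.Normc.normcV. Qed.

Lemma cmod_iX n : cmod ('i%C ^+ n : R[i]) = 1.
Proof.
elim: n => [|n IH]; first exact: ComplexField.Normc.normc1.
by rewrite exprS cmodM IH mulr1 /cmod /= expr0n expr1n add0r sqrtr1.
Qed.

Lemma cmod_expi a : cmod (expi a) = 1.
Proof. by rewrite /cmod /= cos2Dsin2 sqrtr1. Qed.

Lemma Re_le_cmod z : `|complex.Re z| <= cmod z.
Proof.
by case: z => x y; rewrite -sqrtr_sqr ler_wsqrtr// lerDl sqr_ge0.
Qed.

Lemma Im_le_cmod z : `|complex.Im z| <= cmod z.
Proof.
by case: z => x y; rewrite -sqrtr_sqr ler_wsqrtr// lerDr sqr_ge0.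
Qed.

Lemma cmod_le_ReIm z : cmod z <= `|complex.Re z| + `|complex.Im z|.
Proof.
case: z => x y /=.
rewrite -[leRHS]ger0_norm ?addr_ge0// -[leRHS]sqrtr_sqr ler_wsqrtr//.
by rewrite sqrrD !real_normK ?num_real// addrAC lerDl mulrn_wge0 ?mulr_ge0.
Qed.

Lemma Re_sum (I : Type) (r : seq I) (P : pred I) (F : I -> R[i]) :
  complex.Re (\sum_(i <- r | P i) F i) = \sum_(i <- r | P i) complex.Re (F i).
Proof. by apply: (big_morph (@complex.Re R)) => // -[? ?] [? ?]. Qed.

Lemma Im_sum (I : Type) (r : seq I) (P : pred I) (F : I -> R[i]) :
  complex.Im (\sum_(i <- r | P i) F i) = \sum_(i <- r | P i) complex.Im (F i).
Proof. by apply: (big_morph (@complex.Im R)) => // -[? ?] [? ?]. Qed.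

Lemma ReB u v : complex.Re (u - v) = complex.Re u - complex.Re v.
Proof. by case: u v => [? ?] []. Qed.

Lemma ImB u v : complex.Im (u - v) = complex.Im u - complex.Im v.
Proof. by case: u v => [? ?] []. Qed.

Lemma expiD a b : expi (a + b) = expi a * expi b :> R[i].
Proof. by rewrite /expi cosD sinD; simpc; rewrite [cos a * sin b + _]addrC. Qed.

Lemma expi_conj a : conjc (expi a) = expi (- a) :> R[i].
Proof. by rewrite /expi cosN sinN. Qed.

Lemma expiMn a n : expi a ^+ n = expi (n%:R * a) :> R[i].
Proof.
elim: n => [|n IH]; first by rewrite /expi mul0r cos0 sin0.
by rewrite exprS IH -expiD -natr1 mulrDl mul1r addrC.
Qed.

Lemma expi_addN a : expi a + expi (- a) = (2 * cos a)%:C :> R[i].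
Proof. by rewrite /expi cosN sinN; apply/eqP; rewrite eq_complex /= subrr eqxx andbT mulr_natl. Qed.

End Modulus.

(** * Series *)

Section Series.
Context {R : realType}.

(** [csum1] is a totalized limit; comparison with [b] makes the real and
    imaginary parts converge, so that it is the genuine sum of the series. *)
Lemma csum1_abs_cvg (u : nat -> R[i]) (b : nat -> R) :
  (forall s, cmod (u s) <= b s) -> cvgn (series b) ->
  cmod (\sum_(1 <= s < n) u s - csum1 u) @[n --> \oo] --> (0 : R).
Proof.
move=> ub cb.
have Habs (p : R[i] -> R) : (forall z, `|p z| <= cmod z) ->
    cvgn (fun n => \sum_(1 <= s < n) p (u s)).
  move=> pz; have H : cvgn (series (fun s => p (u s))).
    apply: normed_cvg; apply: (series_le_cvg _ _ _ cb) => s /=.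
    - exact: normr_ge0.
    - exact: le_trans (cmod_ge0 _) (ub s).
    - exact: le_trans (pz _) (ub s).
  have /cvg_ex[/= L hL] := H; apply/cvg_ex; exists (L - p (u 0%N)) => /=.
  rewrite -(cvg_shiftn 1).
  rewrite [X in X @ _ --> _](_ : _ =
      (fun n => series (fun s => p (u s)) (n + 1)%N - p (u 0%N))).
    by apply: cvgB; [rewrite (cvg_shiftn 1); exact: hL|exact: cvg_cst].
  apply/funext => n; rewrite /series/= addn1 [in RHS]big_nat_recl//= addrC addKr.
  by rewrite big_add1.
have /cvg_ex[/= lr hr] := Habs _ Re_le_cmod.
have /cvg_ex[/= li hi] := Habs _ Im_le_cmod.
rewrite (@csum1P _ u (lr +i* li))//.
apply: (@squeeze_cvgr _ \oo _ _ (fun=> 0)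
  (fun n => `|\sum_(1 <= s < n) complex.Re (u s) - lr|
          + `|\sum_(1 <= s < n) complex.Im (u s) - li|)).
- near=> n; rewrite cmod_ge0/=; apply: le_trans (cmod_le_ReIm _) _.
  by rewrite ReB ImB Re_sum Im_sum.
- exact: cvg_cst.
- rewrite -[X in _ --> X](addr0 0); apply: cvgD; apply/norm_cvg0P;
    apply/subr_cvg0; assumption.
Unshelve. all: by end_near.
Qed.

Lemma exp_partial_le (x : R) n : 0 <= x -> \sum_(0 <= l < n) exp_coeff x l <= expR x.
Proof.
move=> x0; have -> : expR x = limn (series (exp_coeff x)) by [].
apply: (nondecreasing_cvgn_le _ (is_cvg_series_exp_coeff x)).
by apply: nondecreasing_series => i _ _; rewrite /exp_coeff/= divr_ge0 ?exprn_ge0.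
Qed.

End Series.

(** * Triangular sums collected by difference of indices *)

Lemma sum_shift (V : nmodType) (q n : nat) (P : pred nat) (F : nat -> V) :
  \sum_(0 <= j < n | P j && (q <= j)%N) F j =
  \sum_(0 <= s < n | P (s + q)%N && (s + q < n)%N) F (s + q)%N.
Proof.
rewrite -(big_nat_widenl q 0)// -{1}[q]add0n big_addn (big_nat_widen _ _ n) ?leq_subr//.
by apply: eq_bigl => s; rewrite ltn_subRL addnC.
Qed.

Lemma sum_antidiagonals (V : nmodType) (g : nat -> nat -> V) n :
  \sum_(0 <= p < n) \sum_(0 <= i < p.+1) g (p - i)%N i =
  \sum_(0 <= i < n) \sum_(0 <= j < n | (j + i < n)%N) g j i.
Proof.
transitivity (\sum_(0 <= p < n) \sum_(0 <= i < n | (i <= p)%N) g (p - i)%N i).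
  by apply: eq_big_nat => p pn; rewrite (big_nat_widen _ _ n).
rewrite (exchange_big_dep_nat xpredT)//=; apply: eq_bigr => i _.
rewrite (sum_shift i n xpredT (fun p => g (p - i)%N i))/=.
by apply: eq_bigr => s _; rewrite addnK.
Qed.

(** In the triangle, the pairs with [i <= j] are [(l + s, l)] and those with
    [j < i] are [(l, l + s)] with [s] positive; the diagonal [s = 0] must be
    counted once only, whence the conditional. *)
Lemma sum_triangle_by_difference (V : nmodType) (g : nat -> nat -> V) n :
  \sum_(0 <= i < n) \sum_(0 <= j < n | (j + i < n)%N) g j i =
  \sum_(0 <= s < n) \sum_(0 <= l < n | (l.*2 + s < n)%N)
    (g (l + s)%N l + (if s == 0%N then 0 else g l (l + s)%N)).
Proof.
under [RHS]eq_bigr do rewrite big_split/=.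
rewrite [RHS]big_split/=.
transitivity (\sum_(0 <= i < n)
   (\sum_(0 <= j < n | (j + i < n)%N && (i <= j)%N) g j i
  + \sum_(0 <= j < n | (j + i < n)%N && ~~ (i <= j)%N) g j i)).
  by apply: eq_bigr => i _; rewrite (bigID (fun j => i <= j)%N).
rewrite big_split/=; congr (_ + _).
- under eq_bigr do rewrite sum_shift.
  rewrite (exchange_big_dep_nat xpredT)//=; apply: eq_bigr => s _.
  apply: eq_big => [l|l _]; last by rewrite addnC.
  by lia.
- rewrite (exchange_big_dep_nat xpredT)//=.
  transitivity (\sum_(0 <= j < n) \sum_(0 <= i < n |
      ((j + i < n)%N && (i != j)) && (j <= i)%N) g j i).
    apply: eq_bigr => j _; apply: eq_bigl => i.
    by lia.
  transitivity (\sum_(0 <= j < n) \sum_(0 <= s < n |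
      ((j + (s + j) < n)%N && (s + j != j)%N) && (s + j < n)%N) g j (s + j)%N).
    apply: eq_bigr => j _.
    exact: (sum_shift j n (fun i => (j + i < n)%N && (i != j)) (g j)).
  rewrite (exchange_big_dep_nat xpredT)//=; apply: eq_bigr => s _.
  case: eqVneq => [->|s0].
    by rewrite [RHS]big1//= big_pred0// => l; rewrite add0n eqxx andbF.
  apply: eq_big => [l|l _]; last by rewrite addnC.
  by lia.
Qed.

(** This is the algebraic core of the expansion of [exp (a + b)] into Bessel
    functions: once [a * b = - (x / 2) ^+ 2], the inner sum is a truncated
    Bessel series, up to a power of [x / 2]. *)
Lemma exp_sum_by_difference (F : numFieldType) (a b : F) n :
  \sum_(0 <= p < n) (a + b) ^+ p / p`!%:R =
  \sum_(0 <= s < n) (if s == 0%N then 1 else a ^+ s + b ^+ s) *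
    \sum_(0 <= l < n | (l.*2 + s < n)%N) (a * b) ^+ l / (l`! * (l + s)`!)%:R.
Proof.
pose g j i := a ^+ j / j`!%:R * (b ^+ i / i`!%:R).
have f0 m : m`!%:R != 0 :> F by rewrite pnatr_eq0 -lt0n fact_gt0.
transitivity (\sum_(0 <= p < n) \sum_(0 <= i < p.+1) g (p - i)%N i).
  apply: eq_bigr => p _; rewrite exprDn mulr_suml big_mkord.
  apply: eq_bigr => i _; have ip : (i <= p)%N by rewrite -ltnS.
  rewrite /g -(bin_fact ip) -mulr_natr natrM [(i`! * _)%:R]natrM.
  have C0 : 'C(p, i)%:R != 0 :> F by rewrite pnatr_eq0 -lt0n bin_gt0.
  by field; rewrite ?f0 ?C0.
rewrite sum_antidiagonals sum_triangle_by_difference.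
apply: eq_bigr => s _; rewrite mulr_sumr; apply: eq_bigr => l _.
rewrite /g natrM exprMn; case: eqP => [->|_].
  by rewrite addn0 addr0; field; rewrite f0.
by rewrite !exprD; field; rewrite !f0.
Qed.

(** * Bessel functions and the Jacobi-Anger expansion *)

Section JacobiAnger.
Context {R : realType}.
Implicit Types x X t phi : R.

Definition bessel_term (s : nat) x (l : nat) : R :=
  (-1) ^+ l / (l`! * (l + s)`!)%:R * (x / 2) ^+ (l.*2 + s).

(** The coefficient of J_s in the Jacobi-Anger expansion. *)
Definition jacobi_factor phi (s : nat) : R[i] :=
  if s == 0%N then 1 else 2 * 'i%C ^+ s * (cos (s%:R * phi))%:C.

Lemma exp_coeff_ge0 x n : 0 <= x -> 0 <= exp_coeff x n.
Proof. by move=> x0; rewrite /exp_coeff/= divr_ge0 ?exprn_ge0. Qed.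

(** Bounding [`|x / 2|] by [X / 2] keeps a power of [1 / 2] of the same degree as
    the term. Dropping it gives summable bounds; keeping it makes the tails of
    all the Bessel series decay at one geometric rate. *)
Lemma bessel_term_le x X s l : `|x| <= X ->
  `|bessel_term s x l| <= 2^-1 ^+ (l.*2 + s) * (exp_coeff X s * exp_coeff (X ^+ 2) l).
Proof.
move=> xX; have X0 : 0 <= X := le_trans (normr_ge0 _) xX.
rewrite /bessel_term !normrM normfV normrX normrN1 expr1n normr_nat mul1r normrX.
rewrite normrM normfV normr_nat exprMn.
rewrite /exp_coeff/=.
have -> : 2^-1 ^+ (l.*2 + s) * (X ^+ s / s`!%:R * ((X ^+ 2) ^+ l / l`!%:R)) =
    (l`! * s`!)%:R^-1 * (X ^+ (l.*2 + s) * 2^-1 ^+ (l.*2 + s)) :> R.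
  by rewrite natrM invfM -exprM mul2n !exprD; ring.
apply: ler_pM; rewrite ?invr_ge0 ?ler0n ?mulr_ge0 ?exprn_ge0 ?invr_ge0//.
  rewrite lef_pV2 ?posrE ?ltr0n ?muln_gt0 ?fact_gt0// ler_nat leq_mul2l.
  by rewrite leq_fact ?leq_addl ?orbT.
by rewrite ler_pM ?exprn_ge0 ?invr_ge0// lerXn2r ?nnegrE.
Qed.

Lemma bessel_term_le1 x X s l : `|x| <= X ->
  `|bessel_term s x l| <= exp_coeff X s * exp_coeff (X ^+ 2) l.
Proof.
move=> xX; have X0 : 0 <= X := le_trans (normr_ge0 _) xX.
apply: le_trans (bessel_term_le s l xX) _.
rewrite ler_piMl ?(mulr_ge0 (exp_coeff_ge0 _ _) (exp_coeff_ge0 _ _)) ?sqr_ge0//.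
by rewrite exprn_ile1 ?invr_ge0// invf_le1// ler1n.
Qed.

Lemma besselJ_cvg s x : series (bessel_term s x) @ \oo --> besselJ s x.
Proof.
rewrite /besselJ -/(series (bessel_term s x)).
apply: (@normed_cvg _ R^o).
apply: (@series_le_cvg _ _ (exp_coeff `|x| s *: exp_coeff (`|x| ^+ 2))) => [l|l|l|] /=.
- exact: normr_ge0.
- by rewrite mulr_ge0 ?exp_coeff_ge0 ?sqr_ge0.
- exact: bessel_term_le1.
- by apply: is_cvg_seriesZ; exact: is_cvg_series_exp_coeff.
Qed.

Lemma besselJ_le s x X : `|x| <= X -> `|besselJ s x| <= exp_coeff X s * expR (X ^+ 2).
Proof.
move=> xX; have X0 : 0 <= X := le_trans (normr_ge0 _) xX.
apply: (cvgr_to_le (cvg_norm (@besselJ_cvg s x))).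
near=> n; rewrite /series/=; apply: le_trans (ler_norm_sum _ _ _) _.
apply: le_trans (ler_sum _ (fun l _ => bessel_term_le1 s l xX)) _.
by rewrite -mulr_sumr ler_wpM2l ?exp_coeff_ge0// exp_partial_le ?sqr_ge0.
Unshelve. all: by end_near.
Qed.

(** The truncation is by the total degree [l.*2 + s], as the partial sums of the
    exponential series dictate. The terms left out have degree at least [n], and
    the bound is summable over [s]. *)
Lemma besselJ_truncation x s n :
  `|besselJ s x - \sum_(0 <= l < n | (l.*2 + s < n)%N) bessel_term s x l|
    <= 2^-1 ^+ n * (exp_coeff `|x| s * expR (`|x| ^+ 2)).
Proof.
set B := \sum_(_ <= l < n | _) _.
have cv : series (bessel_term s x) m - B @[m --> \oo] --> besselJ s x - B.
  by apply: cvgB; [exact: besselJ_cvg|exact: cvg_cst].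
apply: (cvgr_to_le (cvg_norm cv)); near=> m.
have nm : (n <= m)%N by near: m; exact: nbhs_infty_ge.
have -> : series (bessel_term s x) m - B =
    \sum_(0 <= l < m | ~~ (l.*2 + s < n)%N) bessel_term s x l.
  rewrite /series/= (bigID (fun l => l.*2 + s < n)%N)/=.
  suff -> : \sum_(0 <= l < m | (l.*2 + s < n)%N) bessel_term s x l = B.
    by rewrite addrAC subrr add0r.
  rewrite /B (big_nat_widen _ n m)//; apply: eq_bigl => l.
  by lia.
apply: le_trans (ler_norm_sum _ _ _) _.
apply: (@le_trans _ _ (\sum_(0 <= l < m | ~~ (l.*2 + s < n)%N)
    2^-1 ^+ n * (exp_coeff `|x| s * exp_coeff (`|x| ^+ 2) l))).
  apply: ler_sum => l; rewrite -leqNgt => nl.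
  apply: le_trans (bessel_term_le s l (lexx _)) _.
  rewrite ler_wpM2r ?(mulr_ge0 (exp_coeff_ge0 _ _) (exp_coeff_ge0 _ _)) ?sqr_ge0//.
  by rewrite ler_wiXn2l// ?invr_ge0// invf_le1// ler1n.
apply: (@le_trans _ _ (\sum_(0 <= l < m)
    2^-1 ^+ n * (exp_coeff `|x| s * exp_coeff (`|x| ^+ 2) l))).
  rewrite big_mkcond/=; apply: ler_sum => l _; case: ifP => // _.
  by rewrite !mulr_ge0 ?exprn_ge0 ?invr_ge0 ?exp_coeff_ge0 ?sqr_ge0.
rewrite -!mulr_sumr ler_wpM2l ?exprn_ge0 ?invr_ge0//.
by rewrite ler_wpM2l ?exp_coeff_ge0// exp_partial_le ?sqr_ge0.
Unshelve. all: by end_near.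
Qed.

Lemma iX_ReIm p : 'i%C ^+ p =
  ((~~ odd p)%:R * (-1) ^+ p./2) +i* ((odd p)%:R * (-1) ^+ p.-1./2) :> R[i].
Proof.
have i2 m : 'i%C ^+ m.*2 = ((-1) ^+ m)%:C :> R[i].
  rewrite -mul2n exprM rmorphXn rmorphN1; congr (_ ^+ m).
  by rewrite expr2; simpc.
rewrite -{1}[p]odd_double_half exprD i2; case: (boolP (odd p)) => op /=.
  rewrite expr1 !mul0r mul1r; simpc; congr (_ +i* (_ ^+ _)).
  by case: p op => //= p; rewrite uphalf_half => /negbTE ->.
by rewrite expr0 mul1r mul0r mul1r.
Qed.

Lemma expi_series t :
  cmod (\sum_(0 <= p < n) ('i%C * t%:C) ^+ p / p`!%:R - expi t)
    @[n --> \oo] --> (0 : R).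
Proof.
have -> : (fun n => cmod (\sum_(0 <= p < n) ('i%C * t%:C) ^+ p / p`!%:R - expi t)) =
  (fun n => cmod ((series (cos_coeff t) n - cos t) +i* (series (sin_coeff t) n - sin t))).
  apply/funext => n; congr cmod.
  have Hp p : ('i%C * t%:C) ^+ p / p`!%:R = cos_coeff t p +i* sin_coeff t p.
    rewrite exprMn iX_ReIm -rmorphXn -(rmorph_nat (real_complex R)) -fmorphV.
    by rewrite /cos_coeff /sin_coeff /=; simpc.
  under eq_bigr do rewrite Hp.
  by apply/eqP; rewrite eq_complex ReB ImB Re_sum Im_sum /series/= !eqxx.
apply: (@squeeze_cvgr _ \oo _ _ (fun=> 0)
  (fun n => `|series (cos_coeff t) n - cos t| + `|series (sin_coeff t) n - sin t|)).
- by near=> n; rewrite cmod_ge0; exact: (le_trans (cmod_le_ReIm _)).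
- exact: cvg_cst.
- rewrite -[X in _ --> X](addr0 0); apply: cvgD; apply/norm_cvg0P; apply/subr_cvg0.
    by rewrite cos.unlock; exact: is_cvg_series_cos_coeff.
  by rewrite sin.unlock; exact: is_cvg_series_sin_coeff.
Unshelve. all: by end_near.
Qed.

Lemma exp_sum_jacobi x phi n :
  \sum_(0 <= p < n) ('i%C * (x * cos phi)%:C) ^+ p / p`!%:R =
  \sum_(0 <= s < n) jacobi_factor phi s *
    (\sum_(0 <= l < n | (l.*2 + s < n)%N) bessel_term s x l)%:C.
Proof.
pose a : R[i] := 'i%C * ((x / 2)%:C * expi phi).
pose b : R[i] := 'i%C * ((x / 2)%:C * expi (- phi)).
have -> : 'i%C * (x * cos phi)%:C = a + b.
  rewrite /a /b -mulrDr -mulrDr expi_addN -rmorphM; congr (_ * _%:C).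
  by rewrite mulrA divfK.
have ab : a * b = (- (x / 2) ^+ 2)%:C.
  rewrite /a /b mulrACA -expr2 sqr_i mulrACA -expiD subrr.
  rewrite /expi cos0 sin0 -rmorphM -expr2 mulr1 mulN1r.
  by rewrite rmorphN.
rewrite exp_sum_by_difference; apply: eq_bigr => s _.
rewrite rmorph_sum/= [LHS]mulr_sumr [RHS]mulr_sumr; apply: eq_bigr => l _.
have -> : (if s == 0%N then 1 else a ^+ s + b ^+ s) =
    jacobi_factor phi s * ((x / 2) ^+ s)%:C.
  rewrite /jacobi_factor; case: eqVneq => [->|s0]; first by rewrite expr0 mulr1.
  rewrite /a /b; move: (x / 2) => h.
  rewrite !exprMn -mulrDr -mulrDr !expiMn mulrN expi_addN rmorphM rmorphXn.
  by rewrite (rmorph_nat _ 2); ring.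
rewrite -mulrA; congr (_ * _).
rewrite ab /bessel_term -(rmorph_nat (real_complex R)) -fmorphV -rmorphXn -!rmorphM.
congr (_%:C); move: (x / 2) => h.
by rewrite -[- h ^+ 2]mulN1r exprMn exprD -mul2n exprM; ring.
Qed.

Lemma cmod_jacobi_factor phi s : cmod (jacobi_factor phi s) <= 2.
Proof.
rewrite /jacobi_factor; case: eqP => _.
  by rewrite (cmod_nat 1) ler1n.
by rewrite !cmodM (cmod_nat 2) cmod_iX cmod_real mulr1 ler_piMr ?cos_max.
Qed.

(** The expansion is compared with the partial sum [T n] of the exponential
    series, which has the same shape with truncated Bessel functions; by
    [besselJ_truncation], the difference is a constant times [2^-1 ^+ n]. *)
Lemma jacobi_anger x phi :
  cmod (expi (x * cos phi) -
        \sum_(0 <= s < n) jacobi_factor phi s * (besselJ s x)%:C)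
    @[n --> \oo] --> (0 : R).
Proof.
pose T n := \sum_(0 <= p < n) ('i%C * (x * cos phi)%:C) ^+ p / p`!%:R : R[i].
apply: (@squeeze_cvgr _ \oo _ _ (fun=> 0) (fun n => cmod (T n - expi (x * cos phi))
   + (2 * expR `|x| * expR (`|x| ^+ 2)) * 2^-1 ^+ n)).
- near=> n; rewrite cmod_ge0/=.
  rewrite -[X in X - _](subrK (T n)) -addrA.
  apply: le_trans (cmodD _ _) _; rewrite cmodB lerD2l.
  rewrite /T exp_sum_jacobi -sumrB; apply: le_trans (cmod_sum _ _ _) _.
  apply: (@le_trans _ _ (\sum_(0 <= s < n)
    2 * (2^-1 ^+ n * (exp_coeff `|x| s * expR (`|x| ^+ 2))))).
    apply: ler_sum => s _; rewrite -mulrBr -rmorphB cmodM cmod_real.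
    rewrite ler_pM ?cmod_ge0 ?cmod_jacobi_factor// distrC.
    exact: besselJ_truncation.
  rewrite -!mulr_sumr -mulr_suml.
  rewrite [leRHS](_ : _ = 2 * (2^-1 ^+ n * (expR `|x| * expR (`|x| ^+ 2)))); last by ring.
  rewrite ler_wpM2l// ler_wpM2l ?exprn_ge0 ?invr_ge0// ler_wpM2r ?expR_ge0//.
  exact: exp_partial_le.
- exact: cvg_cst.
- rewrite -[X in _ --> X](addr0 0); apply: cvgD; first exact: expi_series.
  rewrite -[X in _ --> X](mulr0 (2 * expR `|x| * expR (`|x| ^+ 2))).
  apply: cvgMr; apply: cvg_expr.
  by rewrite ger0_norm ?invr_ge0// invf_lt1// ltr1n.
Unshelve. all: by end_near.
Qed.

End JacobiAnger.

(** * Averages over equidistant angles *)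

Section Averages.
Context {R : realType}.
Implicit Types x X t phi a d : R.

Lemma sin_increment a d : 0 <= d -> `|sin (a + d) - sin a - d * cos a| <= d ^+ 2.
Proof.
move=> d0.
have cs : continuous (sin : R -> R) by exact: continuous_sin.
have cc : continuous (cos : R -> R) by exact: continuous_cos.
have ad : a <= a + d by rewrite lerDl.
have [c] := MVT_segment ad (fun x _ => is_derive_sin x) (continuous_subspaceT cs).
rewrite in_itv/= [X in cos c * X]addrAC subrr add0r => /andP[ac cd] ->.
have [b _ E] := MVT_segment ac (fun x _ => is_derive_cos x) (continuous_subspaceT cc).
have -> : cos c * d - d * cos a = d * (cos c - cos a) by ring.
rewrite E normrM (ger0_norm d0) expr2 ler_wpM2l// normrM normrN.
rewrite -[leRHS]mul1r ler_pM// ?sin_max//.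
by rewrite ger0_norm ?subr_ge0// lerBlDl.
Qed.

Lemma sinc_le1 t : `|sinc t| <= 1.
Proof.
rewrite /sinc; case: eqVneq => [_|t0]; first by rewrite normr1.
wlog tp : t t0 / 0 < t => [H|].
  have [|tn] := ltP 0 t; first exact: H.
  rewrite -mulrNN -invrN -sinN; apply: H; rewrite ?oppr_eq0//.
  by rewrite oppr_gt0 lt_neqAle t0.
have cs : continuous (sin : R -> R) by exact: continuous_sin.
have [c _] := MVT_segment (ltW tp) (fun x _ => is_derive_sin x) (continuous_subspaceT cs).
rewrite sin0 !subr0 => ->.
by rewrite mulfK// cos_max.
Qed.

(** The mean of [cos (s (theta - phi))] over the interval, in a form free of
    integrals: the increment of its antiderivative, multiplied by [s]. *)
Lemma sin_difference_sinc t1 tN phi s :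
  sin (s%:R * (tN - phi)) - sin (s%:R * (t1 - phi)) =
  s%:R * (tN - t1) * (cos (s%:R * (tN + t1 - 2 * phi) / 2)
                      * sinc (s%:R * (tN - t1) / 2)) :> R.
Proof.
set A := s%:R * (tN + t1 - 2 * phi) / 2; set B := s%:R * (tN - t1) / 2.
have -> : s%:R * (tN - phi) = A + B by rewrite /A /B; field.
have -> : s%:R * (t1 - phi) = A - B by rewrite /A /B; field.
have -> : s%:R * (tN - t1) = 2 * B by rewrite /B; field.
have -> : 2 * B * (cos A * sinc B) = 2 * cos A * (B * sinc B) by ring.
have -> : B * sinc B = sin B.
  by rewrite /sinc; case: eqVneq => [->|B0]; rewrite ?mul0r ?sin0// mulrC divfK.
by rewrite sinD sinB; ring.
Qed.

(** The increment of [sin] between consecutive sampling points is the step [d]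
    times the sampled cosine, up to [d ^+ 2], and these increments telescope.
    The linear growth of the bound in [s] is absorbed by the decay of the Bessel
    functions. *)
Lemma cos_average t1 tN phi N s : t1 < tN -> (1 < N)%N -> (0 < s)%N ->
  `|N%:R^-1 * \sum_(n < N) cos (s%:R * (obs_angle t1 tN N n - phi))
    - cos (s%:R * (tN + t1 - 2 * phi) / 2) * sinc (s%:R * (tN - t1) / 2)|
  <= s%:R * (tN - t1 + 2) / N%:R.
Proof.
move=> t1N; case: N => [//|K]; rewrite ltnS => K0 s0.
set L := tN - t1; have L0 : 0 < L by rewrite subr_gt0.
have Kr : 0 < K%:R :> R by rewrite ltr0n.
have sr : 1 <= s%:R :> R by rewrite ler1n.
have sr0 : 0 < s%:R :> R by rewrite ltr0n.
set kap := cos _ * sinc _.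
pose th n := s%:R * (obs_angle t1 tN K.+1 n - phi).
pose d := s%:R * (L / K%:R).
have d0 : 0 < d by rewrite mulr_gt0// divr_gt0.
have thS n : th n.+1 = th n + d.
  by rewrite /th /d /obs_angle/= -natr1 /L; field; rewrite gt_eqF.
have Kd : K%:R * d = s%:R * L by rewrite /d; field; rewrite gt_eqF.
(* [N] points delimit [N.-1] intervals: the first [N.-1] samples form a left
   Riemann sum, and the last sample is treated separately. *)
have stepA : `|K%:R * kap - \sum_(0 <= n < K) cos (th n)| <= s%:R * L.
  rewrite -(ler_pM2l d0) -{1}(gtr0_norm d0) -normrM.
  have -> : d * (K%:R * kap - \sum_(0 <= n < K) cos (th n)) =
      \sum_(0 <= n < K) (sin (th n + d) - sin (th n) - d * cos (th n)).
    rewrite sumrB -mulr_sumr mulrBr; congr (_ - _).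
    under eq_bigr do rewrite -thS.
    rewrite (telescope_sumr (fun n => sin (th n)))// mulrA [d * _]mulrC Kd.
    rewrite -sin_difference_sinc; congr (sin _ - sin _); rewrite /th /obs_angle/=.
      by rewrite divff ?gt_eqF//; ring.
    by rewrite mul0r mul0r addr0.
  apply: le_trans (ler_norm_sum _ _ _) _.
  apply: (@le_trans _ _ (\sum_(0 <= n < K) d ^+ 2)).
    by apply: ler_sum => n _; exact: sin_increment (ltW d0).
  by rewrite sumr_const_nat subn0 -[d ^+ 2 *+ K]mulr_natr -Kd expr2 -mulrA [d * K%:R]mulrC.
have Nr : 0 < K.+1%:R :> R by rewrite ltr0n.
rewrite -[leLHS](mulfK (lt0r_neq0 Nr)) ler_pM2r ?invr_gt0//.
rewrite mulrC -{1}(gtr0_norm Nr) -normrM mulrBr mulrA divff ?gt_eqF// mul1r distrC.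
rewrite -(big_mkord xpredT (fun n => cos (th n))) big_nat_recr//=.
rewrite -natr1 mulrDl mul1r opprD addrACA.
apply: le_trans (ler_normD _ _) _.
rewrite mulrDr lerD//.
apply: (@le_trans _ _ (1 + 1)).
  apply: le_trans (ler_normB _ _) _; rewrite lerD ?cos_max//.
  by rewrite /kap normrM mulr_ile1 ?cos_max ?sinc_le1.
by rewrite -[1 + 1]mul1r ler_pM2r.
Qed.

(** The constant depends on the bound [X] only, neither on [x] nor on [phi]; this
    uniformity is what makes the suprema over the test domain converge. *)
Lemma expi_average t1 tN X : t1 < tN -> exists C : R, forall N x phi,
  (1 < N)%N -> `|x| <= X ->
  cmod (N%:R^-1 * (\sum_(n < N) expi (x * cos (obs_angle t1 tN N n - phi))) -
    ((besselJ 0 x)%:C + 2 * csum1 (fun s => 'i%C ^+ s * (besselJ s x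
      * cos (s%:R * (tN + t1 - 2 * phi) / 2) * sinc (s%:R * (tN - t1) / 2))%:C)))
  <= C / N%:R.
Proof.
move=> t1N; exists (2 * (tN - t1 + 2) * expR (2 * X) * expR (X ^+ 2)).
move=> N x phi N1 xX.
have X0 : 0 <= X := le_trans (normr_ge0 _) xX.
have L0 : 0 < tN - t1 by rewrite subr_gt0.
have Nr : 0 < N%:R :> R by rewrite ltr0n ltnW.
set v := (X in csum1 X).
pose psi (n : 'I_N) := obs_angle t1 tN N n - phi.
pose kap s := cos (s%:R * (tN + t1 - 2 * phi) / 2) * sinc (s%:R * (tN - t1) / 2).
have vb s : cmod (v s) <= (expR (X ^+ 2) *: exp_coeff X) s.
  rewrite /v cmodM cmod_iX mul1r cmod_real -mulrA normrM.
  rewrite [leRHS](_ : _ = exp_coeff X s * expR (X ^+ 2) * 1); last first.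
    by rewrite mulr1 mulrC.
  rewrite ler_pM ?besselJ_le//.
  by rewrite normrM mulr_ile1 ?cos_max ?sinc_le1.
have bcvg : cvgn (series (expR (X ^+ 2) *: exp_coeff X)).
  by apply: is_cvg_seriesZ; exact: is_cvg_series_exp_coeff.
have vcvg := csum1_abs_cvg vb bcvg.
pose P (n : 'I_N) m := \sum_(0 <= s < m) jacobi_factor (psi n) s * (besselJ s x)%:C.
(* The error of truncating all the expansions at order [m]; the inequality is
   proved up to [err m], which then tends to 0 with [N] fixed. *)
pose err m := N%:R^-1 * (\sum_(n < N) cmod (expi (x * cos (psi n)) - P n m))
   + 2 * cmod (\sum_(1 <= s < m) v s - csum1 v).
have err0 : err m @[m --> \oo] --> (0 : R).
  rewrite -[X in _ --> X](addr0 0); apply: cvgD.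
    rewrite -[X in _ --> X](mulr0 N%:R^-1); apply: cvgMr.
    rewrite [X in _ --> X](_ : _ = \sum_(n < N) (0 : R)); last by rewrite big1.
    by apply: cvg_big => [|n _]; [exact: add_continuous|exact: jacobi_anger].
  by rewrite -[X in _ --> X](mulr0 2); apply: cvgMr.
set K := (X in _ <= X).
have errK : err m + K @[m --> \oo] --> 0 + K.
  by apply: cvgD; [exact: err0|exact: cvg_cst].
rewrite -[K]add0r; apply: (cvgr_to_ge errK); near=> m.
have m0 : (0 < m)%N by near: m; exact: nbhs_infty_ge.
set G := N%:R^-1 * _; set S := \sum_(1 <= s < m) v s.
have -> : G - ((besselJ 0 x)%:C + 2 * csum1 v) =
    N%:R^-1 * (\sum_(n < N) (expi (x * cos (psi n)) - P n m))
  + 2 * (S - csum1 v)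
  + (N%:R^-1 * (\sum_(n < N) P n m) - (besselJ 0 x)%:C - 2 * S).
  by rewrite sumrB /G; ring.
apply: le_trans (cmodD _ _) _; apply: lerD.
  apply: le_trans (cmodD _ _) _; apply: lerD.
    rewrite cmodM cmodV cmod_nat ler_wpM2l ?invr_ge0 ?ler0n//.
    exact: cmod_sum.
  by rewrite cmodM (cmod_nat 2).
pose avg s := N%:R^-1 * \sum_(n < N) cos (s%:R * psi n).
have -> : N%:R^-1 * (\sum_(n < N) P n m) - (besselJ 0 x)%:C - 2 * S =
    \sum_(1 <= s < m) 2 * 'i%C ^+ s * (besselJ s x * (avg s - kap s))%:C.
  rewrite /P exchange_big/= big_ltn//.
  under eq_bigr do rewrite {1}/jacobi_factor /= mul1r.
  rewrite sumr_const card_ord mulrDr -[(besselJ 0 x)%:C *+ N]mulr_natl mulKf; last first.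
    by rewrite pnatr_eq0 -lt0n ltnW.
  rewrite [X in X - _]addrAC subrr add0r /S !mulr_sumr -sumrB; apply: eq_big_nat => s /andP[s1 _].
  under eq_bigr do rewrite /jacobi_factor gtn_eqF//.
  rewrite /v /avg -mulr_suml -mulr_sumr -rmorph_sum/=.
  rewrite -(rmorph_nat (real_complex R) N) -fmorphV.
  rewrite -!mulrA -/(kap s) [(N%:R^-1)%:C * _]mulrCA -mulrBr.
  rewrite [(N%:R^-1)%:C * _]mulrCA -mulrBr; congr (_ * (_ * _)).
  by rewrite -!rmorphM -rmorphB; congr _%:C; rewrite /kap -!mulrA; ring.
have C0 : 0 <= 2 * (tN - t1 + 2) * expR (X ^+ 2) / N%:R.
  apply: mulr_ge0; last by rewrite invr_ge0 ltW.
  by rewrite mulr_ge0 ?expR_ge0// mulr_ge0// addr_ge0// ltW.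
apply: le_trans (cmod_sum _ _ _) _.
apply: (@le_trans _ _ (\sum_(1 <= s < m)
    2 * (tN - t1 + 2) * expR (X ^+ 2) / N%:R * exp_coeff (2 * X) s)).
  apply: ler_sum_nat => s /andP[s1 _].
  rewrite !cmodM (cmod_nat 2) cmod_iX mulr1 cmod_real normrM.
  apply: (@le_trans _ _ (2 * (exp_coeff X s * expR (X ^+ 2)
      * (s%:R * (tN - t1 + 2) / N%:R)))).
    by rewrite ler_pM2l// ler_pM// ?besselJ_le// cos_average.
  rewrite [leLHS](_ : _ = 2 * (tN - t1 + 2) * expR (X ^+ 2) / N%:R
      * (s%:R * exp_coeff X s)); last by ring.
  rewrite ler_wpM2l//.
  (* As [s <= 2 ^ s], the factor [s] is absorbed by doubling [X]. *)
  rewrite /exp_coeff/= exprMn mulrA ler_wpM2r ?invr_ge0// ler_wpM2r ?exprn_ge0//.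
  by rewrite -natrX ler_nat ltnW// ltn_expl.
rewrite -mulr_sumr /K.
rewrite [leRHS](_ : _ = 2 * (tN - t1 + 2) * expR (X ^+ 2) / N%:R * expR (2 * X));
  last by ring.
rewrite ler_wpM2l//.
apply: le_trans (exp_partial_le m _); last by rewrite mulr_ge0.
by rewrite [leRHS]big_ltn// lerDr exp_coeff_ge0// mulr_ge0.
Unshelve. all: by end_near.
Qed.

End Averages.

(** * The normalized indicator *)

Section Imaging.
Context {R : realType}.
Implicit Types (F G : R * R -> R[i]) (Omega : set (R * R)) (p z : R * R).

Lemma max_mod_scale_le Omega F (a : R) : Omega !=set0 ->
  has_ubound [set cmod (F y) | y in Omega] -> 0 <= a ->
  max_mod Omega (fun y => a%:C * F y) <= a * max_mod Omega F.
Proof.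
move=> [z Oz] Fb a0; apply: ge_sup; first by exists (cmod (a%:C * F z)), z.
move=> _ [y Oy <-]; rewrite cmodM cmod_real ger0_norm// ler_wpM2l//.
by apply: ub_le_sup => //; exists y.
Qed.

Lemma max_mod_scale Omega F (a : R) : Omega !=set0 ->
  has_ubound [set cmod (F y) | y in Omega] -> 0 < a ->
  max_mod Omega (fun y => a%:C * F y) = a * max_mod Omega F.
Proof.
move=> O0 Fb a0; apply/eqP; rewrite eq_le max_mod_scale_le//; last exact: ltW.
rewrite -ler_pdivlMl//.
have -> : max_mod Omega F = max_mod Omega (fun y => (a^-1)%:C * (a%:C * F y)).
  congr (max_mod _ _); apply/funext => y.
  by rewrite mulrA -rmorphM mulVf ?gt_eqF// mul1r.
apply: max_mod_scale_le => //; last by rewrite invr_ge0 ltW.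
case: Fb => B FB; exists (a * B) => _ [y Oy <-].
by rewrite cmodM cmod_real gtr0_norm// ler_pM2l// FB//; exists y.
Qed.

Lemma max_mod_dist Omega F G (e : R) : Omega !=set0 ->
  has_ubound [set cmod (F y) | y in Omega] ->
  has_ubound [set cmod (G y) | y in Omega] ->
  (forall y, Omega y -> cmod (G y - F y) <= e) ->
  `|max_mod Omega G - max_mod Omega F| <= e.
Proof.
move=> [z Oz] Fb Gb FG.
have half F' G' : has_ubound [set cmod (F' y) | y in Omega] ->
    (forall y, Omega y -> cmod (G' y - F' y) <= e) ->
    max_mod Omega G' <= max_mod Omega F' + e.
  move=> Fb' FG'; apply: ge_sup; first by exists (cmod (G' z)), z.
  move=> _ [y Oy <-]; rewrite -[G' y](subrK (F' y)) addrC.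
  apply: le_trans (cmodD _ _) _; apply: lerD; last exact: FG'.
  by apply: ub_le_sup => //; exists y.
by rewrite ler_distl lerBlDr !half// => y Oy; rewrite cmodB FG.
Qed.

(** Convergence at [z] alone would not control the denominators; a rate common to
    all points of [Omega] does. *)
Lemma normalized_cvg Omega F (G : nat -> R * R -> R[i]) (B C : R) z :
  Omega z ->
  (forall N y, cmod (G N y) <= B) ->
  (forall N y, (1 < N)%N -> Omega y -> cmod (G N y - F y) <= C / N%:R) ->
  max_mod Omega F != 0 ->
  cmod (G N z) / max_mod Omega (G N) @[N --> \oo] --> cmod (F z) / max_mod Omega F.
Proof.
move=> Oz GB GF F0; have O0 : Omega !=set0 by exists z.
have Gb N : has_ubound [set cmod (G N y) | y in Omega] by exists B => _ [y _ <-].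
have Fb : has_ubound [set cmod (F y) | y in Omega].
  (* [F] inherits a bound from its approximation with [N = 2]. *)
  exists (B + C / 2) => _ [y Oy <-].
  rewrite -[F y](subrK (G 2%N y)) addrC; apply: le_trans (cmodD _ _) _.
  by rewrite lerD// cmodB GF.
have C0 : (C / N%:R : R) @[N --> \oo] --> (0 : R).
  rewrite -[X in _ --> X](mulr0 C); apply: cvgMr.
  by rewrite -(cvg_shiftS (fun N => N%:R^-1 : R)); exact: cvg_harmonic.
have by_rate (f : nat -> R) a :
    (forall N, (1 < N)%N -> `|f N - a| <= C / N%:R) -> f N @[N --> \oo] --> a.
  move=> fa; apply/subr_cvg0/norm_cvg0P.
  apply: (@squeeze_cvgr _ \oo _ _ (fun=> 0) (fun N => C / N%:R)) => //.
    near=> N; rewrite normr_ge0/= fa//; near: N; exact: nbhs_infty_gt.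
  exact: cvg_cst.
apply: cvgM; last apply: cvgV => //; apply: by_rate => N N1.
- apply: le_trans (GF N z N1 Oz).
  have half u v : cmod u <= cmod v + cmod (u - v).
    by rewrite -[X in cmod X <= _](subrK v) addrC cmodD.
  by rewrite ler_distl lerBlDr half andbT cmodB half.
- by apply: max_mod_dist => // y Oy; exact: GF.
Unshelve. all: by end_near.
Qed.

Lemma enorm_le p : enorm p <= `|p.1| + `|p.2|.
Proof.
have := cmod_le_ReIm (p.1 +i* p.2).
by rewrite /enorm /dot -!expr2.
Qed.

Lemma enormB_bounded Omega p : bounded_set Omega ->
  exists B, forall z, Omega z -> enorm (z - p) <= B.
Proof.
case=> A [_ /(_ (A + 1))]; rewrite ltrDl ltr01 => /(_ isT) OA.
exists ((A + 1 + `|p.1|) + (A + 1 + `|p.2|)) => z /OA; rewrite /= prod_normE ge_max.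
move=> /andP[z1 z2]; apply: le_trans (enorm_le _) _.
by apply: lerD; apply: le_trans (ler_normB _ _) _; rewrite lerD2r.
Qed.

Lemma dot_unit_vec (t : R) z :
  dot (unit_vec t) z = enorm z * cos (t - polar_angle z).
Proof. by rewrite {1}(polar_angleP z) cosB /dot /unit_vec /=; ring. Qed.

Lemma dotBr p z y : dot p (z - y) = dot p z - dot p y.
Proof. by rewrite /dot/=; ring. Qed.

(** The sampled average of the data of a unit point source at the origin; it tends
    to [J_0 + R]. *)
Definition kernel_average (k t1 tN : R) (N : nat) z : R[i] :=
  N%:R^-1 * \sum_(n < N) expi (2 * k * dot (unit_vec (obs_angle t1 tN N n)) z).

Lemma cmod_kernel_average k t1 tN N z : cmod (kernel_average k t1 tN N z) <= 1.
Proof.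
rewrite /kernel_average cmodM cmodV cmod_nat.
have [->|N0] := posnP N; first by rewrite invr0 mul0r.
rewrite mulrC ler_pdivrMr ?ltr0n// mul1r; apply: le_trans (cmod_sum _ _ _) _.
under eq_bigr do rewrite cmod_expi.
by rewrite sumr_const card_ord.
Qed.

Lemma kernel_average_cvg (k t1 tN B : R) : 0 <= k -> t1 < tN ->
  exists C, forall N z, (1 < N)%N -> enorm z <= B ->
  cmod (kernel_average k t1 tN N z
        - ((besselJ 0 (2 * k * enorm z))%:C + Rker z (2 * k) t1 tN)) <= C / N%:R.
Proof.
move=> k0 t1N; have [C HC] := @expi_average R t1 tN (2 * k * B) t1N.
exists C => N z N1 zB.
rewrite /kernel_average; under eq_bigr do rewrite dot_unit_vec mulrA.
apply: HC => //; rewrite ger0_norm ?ler_wpM2l ?mulr_ge0// ?sqrtr_ge0//.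
Qed.

Lemma sampled_average_kernel (M : nat) (c : 'I_M -> R * R) (alpha eps : 'I_M -> R)
    (D : 'I_M -> set (R * R)) (eps0 mu0 k t1 tN : R) N z :
  sampled_average (far_field_lead c alpha D eps eps0 mu0 k) k t1 tN N z =
  (Num.sqrt (eps0 * mu0))^-1%:C *
  \sum_(m < M) (weight (alpha m) (eps m) eps0 (D m))%:C
     * kernel_average k t1 tN N (z - c m).
Proof.
rewrite /sampled_average /far_field_lead.
under eq_bigr do rewrite mulr_suml.
rewrite exchange_big mulr_sumr [RHS]mulr_sumr; apply: eq_bigr => m _.
rewrite /kernel_average; set X := N%:R^-1.
rewrite [RHS]mulrA [RHS]mulrCA; congr (_ * _).
rewrite [RHS]mulr_sumr; apply: eq_bigr => n _.
rewrite expi_conj -mulrA -expiD -rmorphM; congr (_%:C * expi _).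
  by rewrite /weight; ring.
by rewrite dotBr; ring.
Qed.

End Imaging.

Theorem theorem3p1 (R : realType)
  (* background *)
  (eps0 mu0 omega k : R)
  (heps0 : 0 < eps0) (hmu0 : 0 < mu0) (homega : 0 < omega)
  (hk : k = omega * Num.sqrt (eps0 * mu0))
  (* inhomogeneities; the wavelength is 2 * pi / k *)
  (M : nat) (c : 'I_M -> R * R) (alpha : 'I_M -> R)
  (D : 'I_M -> set (R * R)) (eps : 'I_M -> R)
  (hDmeas : forall m, plane_measurable (D m))
  (hDbnd : forall m, bounded_set (D m))
  (halpha : forall m, 0 < alpha m)
  (heps : forall m, 0 < eps m)
  (hsmall : forall m, alpha m < (2 * pi / k) / 2)
  (l : R) (hl : 0 < l)
  (hsep : forall m m' : 'I_M, m != m' ->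
    l < dist_sets (inhomogeneity (c m) (alpha m) (D m))
                  (inhomogeneity (c m') (alpha m') (D m')))
  (* aperture and test domain *)
  (t1 tN : R) (ht : t1 < tN)
  (hI : [set` `[t1, tN]] `<` [set` `[0, 2 * pi]])
  (Omega : set (R * R)) (hOmega : compact Omega) :
  let w := fun m => weight (alpha m) (eps m) eps0 (D m) in
  let F := fun z : R * R =>
    (Phi_MSM w c k z)%:C + Lambda_MSM w c k t1 tN z in
  max_mod Omega F != 0 ->
  forall z : R * R, Omega z ->
    I_MSM Omega (far_field_lead c alpha D eps eps0 mu0 k) k t1 tN N z
      @[N --> \oo] --> cmod (F z) / max_mod Omega F.
Proof.
move=> w F F0 z Oz.
have k0 : 0 <= k by rewrite hk mulr_ge0 ?sqrtr_ge0 ?(ltW homega).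
have a0 : 0 < (Num.sqrt (eps0 * mu0))^-1.
  by rewrite invr_gt0 sqrtr_gt0 mulr_gt0.
set a := (Num.sqrt _)^-1 in a0.
pose G N y := \sum_(m < M) (w m)%:C * kernel_average k t1 tN N (y - c m).
have FE y : F y = \sum_(m < M) (w m)%:C *
    ((besselJ 0 (2 * k * enorm (y - c m)))%:C + Rker (y - c m) (2 * k) t1 tN).
  rewrite /F /Phi_MSM /Lambda_MSM rmorph_sum/= -big_split/=.
  by apply: eq_bigr => m _; rewrite mulrDr rmorphM.
pose B := \sum_(m < M) `|w m|.
have GB N y : cmod (G N y) <= B.
  apply: le_trans (cmod_sum _ _ _) _; apply: ler_sum => m _.
  by rewrite cmodM cmod_real ler_piMr// cmod_kernel_average.
have rate (m : 'I_M) : exists C : R, forall N y, (1 < N)%N -> Omega y ->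
    cmod (kernel_average k t1 tN N (y - c m)
      - ((besselJ 0 (2 * k * enorm (y - c m)))%:C + Rker (y - c m) (2 * k) t1 tN))
    <= C / N%:R.
  have [b hb] := enormB_bounded (c m) (compact_bounded hOmega).
  have [C hC] := @kernel_average_cvg R k t1 tN b k0 ht.
  by exists C => N y N1 Oy; apply: hC => //; exact: hb.
have [C hC] := choice rate.
have GF N y : (1 < N)%N -> Omega y ->
    cmod (G N y - F y) <= (\sum_(m < M) `|w m| * C m) / N%:R.
  move=> N1 Oy; rewrite FE /G -sumrB mulr_suml.
  apply: le_trans (cmod_sum _ _ _) _; apply: ler_sum => m _.
  by rewrite -mulrBr cmodM cmod_real -[leRHS]mulrA ler_wpM2l// hC.
rewrite [X in X @ _ --> _](_ : _ = fun N => cmod (G N z) / max_mod Omega (G N)).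
  exact: normalized_cvg GB GF F0.
apply/funext => N; rewrite /I_MSM.
rewrite (_ : sampled_average _ _ _ _ _ = fun y => a%:C * G N y); last first.
  by apply/funext => y; exact: sampled_average_kernel.
rewrite max_mod_scale//; [|by exists z|by exists B => _ [y _ <-]].
by rewrite cmodM cmod_real gtr0_norm// -mulf_div divff ?gt_eqF// mul1r.
Qed.
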